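(* Let $a_1,\dots,a_d$ be pairwise relatively prime positive integers and let $n\in\mathbb{Z}$. Suppose one of the following holds: (i) $1-\min\{a_1,\dots,a_d\}\le n\le -1$; (ii) $1\le n\le a_1+\cdots+a_d-1$; (iii) $a_1+\cdots+a_d+1\le n\le a_1+\cdots+a_d+\min\{a_1,\dots,a_d\}-1$. Then \[S_{(a_2,\dots,a_d;a_1)}(n)+S_{(a_1,a_3,\dots,a_d;a_2)}(n)+\cdots+S_{(a_1,\dots,a_{d-1};a_d)}(n)=-\mathrm{poly}_{\{a_1,\dots,a_d\}}(-n).\]
   Context: For an integer $b\ge1$, $\xi_b=e^{2\pi i/b}$ and positive integers $c_1,\dots,c_k$ coprime to $b$, $S_{(c_1,\dots,c_k;b)}(n)=\frac1b\sum_{j=1}^{b-1}\frac{\xi_b^{jn}}{(1-\xi_b^{jc_1})\cdots(1-\xi_b^{jc_k})}$ (an empty sum, i.e. $0$, when $b=1$; the denominator is $1$ when $k=0$). The $m$th summand on the left omits $a_m$ from the list and uses modulus $a_m$. The polynomial $\mathrm{poly}_{\{a_1,\dots,a_d\}}(t)$ is the polynomial part of the restricted partition function $p_{\{a_1,\dots,a_d\}}(n)=\#\{(m_1,\dots,m_d)\in\mathbb{Z}_{\ge0}^d:m_1a_1+\cdots+m_da_d=n\}$, explicitly \[\mathrm{poly}_{\{a_1,\dots,a_d\}}(t)=\frac{1}{a_1\cdots a_d}\sum_{m=0}^{d-1}\frac{(-1)^m}{(d-1-m)!}\sum_{k_1+\cdots+k_d=m}a_1^{k_1}\cdots a_d^{k_d}\frac{B_{k_1}\cdots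 B_{k_d}}{k_1!\cdots k_d!}t^{d-1-m},\] with $k_i\ge0$ and $B_j$ the Bernoulli numbers ($B_1=-\tfrac12$). *)

(* Defs.v *)
From mathcomp Require Import all_boot all_order all_algebra.
From mathcomp Require Import reals trigo.
From mathcomp Require Import complex.
Set Implicit Arguments.
Unset Strict Implicit.
Unset Printing Implicit Defensive.
Import Order.TTheory GRing.Theory Num.Theory.
Local Open Scope ring_scope.

(* bernoulli_seq n = [:: B_0; ...; B_(n-1)], computed from the recurrence
   \sum_(k <= n) 'C(n+1, k) B_k = [n = 0], which is bernoulli_sum below. *)
Fixpoint bernoulli_seq (n : nat) : seq rat :=
  if n is m.+1 then
    let s := bernoulli_seq m in
    rcons s (((m == 0)%N%:R - \sum_(k < m) 'C(m.+1, k)%:R * s`_k) / m.+1%:R)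
  else [::].

Definition bernoulli (n : nat) : rat := (bernoulli_seq n.+1)`_n.

Lemma size_bernoulli_seq n : size (bernoulli_seq n) = n.
Proof. by elim: n => //= n IHn; rewrite size_rcons IHn. Qed.

Lemma nth_bernoulli_seq n k : (k < n)%N -> (bernoulli_seq n)`_k = bernoulli k.
Proof.
elim: n => // n IHn; rewrite ltnS leq_eqVlt => /orP[/eqP -> // | lt_kn].
by rewrite /= nth_rcons size_bernoulli_seq lt_kn IHn.
Qed.

Lemma bernoulli_sum n :
  \sum_(k < n.+1) 'C(n.+1, k)%:R * bernoulli k = (n == 0)%N%:R.
Proof.
rewrite big_ord_recr /= {2}/bernoulli /= nth_rcons size_bernoulli_seq ltnn eqxx.
rewrite binSn mulrC divfK ?pnatr_eq0 //.
under [X in _ - X]eq_bigr => k _ do rewrite nth_bernoulli_seq //.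
by rewrite addrC subrK.
Qed.

Lemma bernoulli1 : bernoulli 1 = - 2^-1.
Proof. by rewrite /bernoulli /= !(big_ord0, big_ord_recl). Qed.

(* e ^ (2 i pi / b) *)
Definition xi (R : realType) (b : nat) : R[i] :=
  let t : R := 2 * pi / b%:R in (cos t +i* sin t)%C.

Definition fourier_dedekind (R : realType) (c : seq nat) (b : nat) (n : int)
    : R[i] :=
  b%:R^-1 *
  \sum_(1 <= j < b)
     xi R b ^ (j%:Z * n) / \prod_(ci <- c) (1 - xi R b ^+ (j * ci)).

(* The inner sum runs over all (k_1, ..., k_d) with k_1 + ... + k_d = m; each
   such k_i is at most m, hence the finite codomain 'I_m.+1. *)
Definition poly_part (d : nat) (a : 'I_d -> nat) : {poly rat} :=
  (\prod_(i < d) (a i)%:R)^-1 *: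
  \sum_(m < d)
    ((-1) ^+ m / (d - 1 - m)`!%:R *
     \sum_(k : {ffun 'I_d -> 'I_m.+1} | (\sum_(i < d) k i)%N == m)
        \prod_(i < d) ((a i)%:R ^+ k i * (bernoulli (k i) / (k i)`!%:R)))
    *: 'X^(d - 1 - m).

Definition min_fam (d : nat) (hd : (0 < d)%N) (a : 'I_d -> nat) : nat :=
  \big[minn/a (Ordinal hd)]_(i < d) a i.

(* Main.v *)
(* Let g_A(n) be the Fourier-Dedekind sum of the subfamily A at n plus
   poly_A(-n), where
     -poly_A(-n) = Res_(t=0) e^(nt) / prod_(i in A) (1 - e^(a_i t)).
   Cancelling a factor 1 - z^(a_i) in both parts gives
     g_A(n) - g_A(n + a_i) = g_(A \ i)(n).
   On 0 < n < sum_A a, by induction on |A|, g_A is thus a_i-periodic for every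
   i in A; two coprime periods p, q force a function on an interval of
   p + q - 1 integers to be constant.  The constant is 0, as the sum of
   g_A(1 + x_1 + ... + x_r) over the box 0 <= x_i < a_i vanishes: this sum
   multiplies each term by prod_i (1 - z^(a_i))/(1 - z), which kills the roots
   of unity z != 1, and leaves Res_(t=0) e^t / (1 - e^t)^r = 0 at z = 1, for
   r >= 2.
   The ranges (i) and (iii) follow from (ii) by one more shift, by induction
   on |A|. *)
Require Import Defs.
From mathcomp Require Import all_boot all_order all_algebra.
From mathcomp Require Import qpoly zify ring.
From mathcomp Require Import reals trigo.
From mathcomp Require Import complex.
Set Implicit Arguments.
Unset Strict Implicit.
Unset Printing Implicit Defensive.
Import Order.TTheory GRing.Theory Num.Theory.
Local Open Scope ring_scope.

(** * Functions on an interval with two coprime periods *)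

(** Euclid's algorithm by subtraction: on the first [M - p] integers [f] also has period [q - p],
    and any larger argument drops into that range on subtracting [p]. *)
Lemma coprime_periods_const (T : Type) (f : nat -> T) (p q M : nat) :
    (0 < p)%N -> (0 < q)%N -> coprime p q -> (p + q <= M.+1)%N ->
    (forall x, 0 < x -> x + p <= M -> f (x + p) = f x)%N ->
    (forall x, 0 < x -> x + q <= M -> f (x + q) = f x)%N ->
  forall x y, (0 < x <= M)%N -> (0 < y <= M)%N -> f x = f y.
Proof.
have [k] := ubnP (p + q)%N; elim: k p q M => // k IHk p q M.
wlog le_pq: p q / (p <= q)%N => [IH | ].
  have [le_pq | /ltnW le_qp] := leqP p q; first exact: IH.
  rewrite addnC coprime_sym => ltk p0 q0 pq leM fp fq.
  exact: (IH q p).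
move=> ltk p0 q0 pq leM fp fq.
have [p1|p1] := eqVneq p 1%N.
  have f1 x : (0 < x <= M)%N -> f x = f 1%N.
    elim: x => // -[|x] // IHx /andP[_ leX].
    by rewrite -IHx ?(ltnW leX) // -(fp x.+1) // p1 addn1.
  by move=> x y hx hy; rewrite (f1 x) // (f1 y).
have lt_pq: (p < q)%N.
  rewrite ltn_neqAle le_pq andbT; apply: contraNneq p1 => epq.
  by move: pq; rewrite epq /coprime gcdnn.
have cst x y : (0 < x <= M - p)%N -> (0 < y <= M - p)%N -> f x = f y.
  apply: (IHk p (q - p)%N) => //; try lia.
  - by move: pq; rewrite -{1}(subnK le_pq) /coprime gcdnDr.
  - by move=> z z0 zM; apply: fp => //; lia.
  - move=> z z0 zM; rewrite -(fp (z + (q - p))%N); try lia.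
    by rewrite -addnA subnK // fq //; lia.
have red x : (0 < x <= M)%N -> exists2 y, (0 < y <= M - p)%N & f x = f y.
  move=> hx; have [le|lt] := leqP x (M - p)%N; first by exists x => //; lia.
  by exists (x - p)%N; [lia | rewrite -(fp (x - p)%N) ?subnK //; lia].
move=> x y /red[x' hx ->] /red[y' hy ->]; exact: cst.
Qed.

(** * Vanishing deduced from the shift relation *)

Section Vanishing.

Variables (I : finType) (a : I -> nat) (F : numDomainType).
Variable g : {set I} -> int -> F.
Hypothesis a_gt0 : forall i, (0 < a i)%N.
Hypothesis a_coprime : forall i j, i != j -> coprime (a i) (a j).
Hypothesis g_set0 : forall n, g set0 n = 0.
Hypothesis g_shift : forall (A : {set I}) i n, i \in A ->
  g A n - g A (n + (a i)%:Z) = g (A :\ i) n.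
Hypothesis g_set1 : forall i (n : nat), (0 < n < a i)%N -> g [set i] n = 0.
Hypothesis g_sum : forall A : {set I}, (1 < #|A|)%N ->
  exists s : seq nat,
    [/\ (0 < size s)%N, all (fun k => 0 < k < \sum_(i in A) a i)%N s
      & \sum_(k <- s) g A k = 0].

Lemma vanishing_middle (A : {set I}) (n : nat) :
  (0 < n < \sum_(i in A) a i)%N -> g A n = 0.
Proof.
have [k] := ubnP #|A|; elim: k A n => // k IHk A n.
rewrite ltnS => leA hn.
have [A0|/set0Pn[i iA]] := eqVneq A set0; first by rewrite A0 g_set0.
have [Ai|/set0Pn[j]] := eqVneq (A :\ i) set0.
  have A1 : A = [set i] by rewrite -(setD1K iA) Ai setU0.
  by move: hn; rewrite A1 big_set1 => /g_set1.
rewrite in_setD1 => /andP[ji jA].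
have cA : (1 < #|A|)%N.
  by rewrite (cardsD1 i) iA (cardsD1 j) in_setD1 ji jA.
(* If [x + a l] is below the sum over [A], then [x] is below the sum over [A :\ l], where induction
   applies. *)
have per l x : l \in A -> (0 < x)%N -> (x + a l <= (\sum_(i in A) a i).-1)%N ->
    g A (x + a l)%N = g A x.
  move=> lA x0 xle; apply/esym/eqP.
  rewrite -subr_eq0 PoszD g_shift //; apply/eqP.
  apply: IHk; first by move: leA; rewrite (cardsD1 l) lA; lia.
  by move: xle; rewrite (big_setD1 l lA) /=; lia.
have sA : (a i + a j <= \sum_(i in A) a i)%N.
  by rewrite (big_setD1 i iA) (big_setD1 j) ?in_setD1 ?ji //=; lia.
have cst x : (0 < x < \sum_(i in A) a i)%N -> g A x = g A n.
  move=> hx.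
  apply: (@coprime_periods_const _ (fun x : nat => g A x) (a i) (a j)
           (\sum_(i in A) a i).-1) => //; try lia.
  - by apply: a_coprime; rewrite eq_sym.
  - by move=> z z0 zle; apply: per.
  - by move=> z z0 zle; apply: per.
have [s [s0 /allP sP]] := g_sum cA.
rewrite (eq_big_seq (fun=> g A n)) => [|x xs]; last exact/cst/sP.
rewrite big_const_seq count_predT iter_addr_0 => /eqP.
by rewrite mulrn_eq0 eqn0Ngt s0 /= => /eqP.
Qed.

(** Shifting by [a i] leads to [a i - n], in the middle range, and the difference, the value for
    [A :\ i], vanishes by induction. *)
Lemma vanishing_negative (A : {set I}) (n : nat) :
  (0 < n)%N -> (forall i, i \in A -> n < a i)%N -> g A (- n%:Z) = 0.
Proof.
have [k] := ubnP #|A|; elim: k A => // k IHk A; rewrite ltnS => leA n0 hn.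
have [A0|/set0Pn[i iA]] := eqVneq A set0; first by rewrite A0 g_set0.
have := g_shift (- n%:Z) iA.
rewrite (IHk (A :\ i)) //; last 2 first.
- by move: leA; rewrite (cardsD1 i) iA.
- by move=> j; rewrite in_setD1 => /andP[_ /hn].
have := hn i iA => ni.
have -> : - n%:Z + (a i)%:Z = (a i - n)%N by lia.
rewrite vanishing_middle ?subr0 //.
by rewrite (big_setD1 i iA) /=; lia.
Qed.

(** The shift starts [n] above the sum over [A :\ i]; since [n < a i], this point is in the middle
    range of [A]. *)
Lemma vanishing_top (A : {set I}) (n : nat) :
  (0 < n)%N -> (forall i, i \in A -> n < a i)%N ->
  g A (\sum_(i in A) a i + n)%N = 0.
Proof.
have [k] := ubnP #|A|; elim: k A => // k IHk A; rewrite ltnS => leA n0 hn.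
have [A0|/set0Pn[i iA]] := eqVneq A set0; first by rewrite A0 g_set0.
have := g_shift (\sum_(j in A :\ i) a j + n)%N iA.
rewrite (IHk (A :\ i)) //; last 2 first.
- by move: leA; rewrite (cardsD1 i) iA.
- by move=> j; rewrite in_setD1 => /andP[_ /hn].
have := hn i iA => ni; rewrite vanishing_middle; last first.
  by rewrite (big_setD1 i iA) /=; lia.
rewrite sub0r => /eqP; rewrite oppr_eq0 => /eqP gA.
by rewrite -[RHS]gA; congr (g A _); rewrite (big_setD1 i iA) /=; lia.
Qed.

End Vanishing.

(** * Roots of unity *)

Lemma xiX (R : realType) (b k : nat) :
  xi R b ^+ k =
  (cos (2 * pi / b%:R * k%:R) +i* sin (2 * pi / b%:R * k%:R))%C.
Proof.
elim: k => [|k IHk]; first by rewrite expr0 mulr0 cos0 sin0.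
have -> : k.+1%:R = k%:R + 1 :> R by rewrite -addn1 natrD.
rewrite exprSr {}IHk [_ * (k%:R + 1)]mulrDr mulr1 cosD sinD.
by apply/eqP; rewrite eq_complex /=; apply/andP; split; apply/eqP; ring.
Qed.

(** If the order [m] were less than [b], then [x = pi * (m / b)], strictly between 0 and [pi], would
    satisfy cos(2x) = 1, hence sin x = 0. *)
Lemma xi_prim (R : realType) (b : nat) :
  (0 < b)%N -> b.-primitive_root (xi R b).
Proof.
move=> b0; have bR : b%:R != 0 :> R by rewrite pnatr_eq0 -lt0n.
have xib : xi R b ^+ b = 1.
  rewrite xiX divfK // mulr2n mulrDl mul1r -mulr2n cos2pi.
  by rewrite mulr2n sinD sinpi mulr0 mul0r addr0.
have [m mP mb] := prim_order_exists b0 xib.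
suff bm : b = m by rewrite {1}bm.
apply/eqP; rewrite eqn_leq (dvdn_leq b0 mb) andbT leqNgt; apply/negP => ltmb.
have m0 := prim_order_gt0 mP.
have /eqP := prim_expr_order mP; rewrite xiX eq_complex /=.
case/andP=> /eqP cos1 _.
pose x : R := pi * (m%:R / b%:R).
have x0 : 0 < x < pi.
  rewrite /x mulr_gt0 ?pi_gt0 ?divr_gt0 ?ltr0n //=.
  by rewrite gtr_pMr ?pi_gt0 // ltr_pdivrMr ?ltr0n // mul1r ltr_nat.
have := sin_gt0_pi x0; rewrite lt0r -sqrf_eq0 sin2cos2 => /andP[].
suff : 1 - cos x ^+ 2 = 0 by move=> ->; rewrite eqxx.
have : cos (x *+ 2) = 1 by rewrite -cos1 /x; congr cos; rewrite mulr2n; field.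
rewrite cos_mulr2n => e.
have -> : 1 - cos x ^+ 2 = - ((cos x ^+ 2 *+ 2 - 1) - 1) / 2 by field.
by rewrite e subrr oppr0 mul0r.
Qed.

(** * Sums over a box and geometric sums *)

(** Values are listed with multiplicity, so that their powers of [x] add up to a product of
    geometric sums. *)
Fixpoint box_sums (s : seq nat) : seq nat :=
  if s is b :: s' then [seq (x + y)%N | x <- iota 0 b, y <- box_sums s']
  else [:: 0].

Lemma sum_expr_box_sums (A : comNzRingType) (x : A) (s : seq nat) :
  \sum_(k <- box_sums s) x ^+ k = \prod_(b <- s) \sum_(0 <= j < b) x ^+ j.
Proof.
elim: s => [|b s IHs] /=; first by rewrite big_seq1 big_nil expr0.
rewrite big_cons -IHs big_allpairs_dep /index_iota subn0 mulr_suml.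
apply: eq_bigr => j _; rewrite mulr_sumr; apply: eq_bigr => k _.
by rewrite exprD.
Qed.

Lemma size_box_sums_gt0 (s : seq nat) :
  all (leq 1) s -> (0 < size (box_sums s))%N.
Proof.
elim: s => //= b s IHs /andP[b0 /IHs s0].
by rewrite size_allpairs size_iota muln_gt0 b0.
Qed.

Lemma box_sums_bound (s : seq nat) (k : nat) :
  k \in box_sums s -> (k + size s <= sumn s)%N.
Proof.
elim: s k => [|b s IHs] k /=; first by rewrite inE => /eqP ->.
by case/allpairsP => -[x y] /= [+ /IHs le ->]; rewrite mem_iota; lia.
Qed.

(** Multiplying by [z ^ n - 1], nonzero by primitivity, telescopes the sum to z^(nb) - 1 = 0. *)
Lemma sum_prim_root_exprz (F : fieldType) (b : nat) (z : F) (n : int) :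
  b.-primitive_root z -> ~~ (b %| `|n|)%N ->
  \sum_(0 <= j < b) z ^ (j%:Z * n) = 0.
Proof.
move=> zP nb.
have z0 : z \is a GRing.unit.
  by rewrite unitfE (prim_root_eq0 zP) -lt0n (prim_order_gt0 zP).
have h : (z ^ n) ^+ b = 1.
  rewrite exprnP exprz_exp mulrC -exprz_exp -exprnP.
  by rewrite prim_expr_order // exp1rz.
have h1 : z ^ n - 1 != 0.
  rewrite subr_eq0; apply: contra nb => /eqP.
  case: n {h} => k /=.
    by rewrite -exprnP => e; rewrite (prim_order_dvd zP) e.
  have -> : z ^ Negz k = (z ^+ k.+1)^-1 by [].
  by move=> /eqP; rewrite invr_eq1 => /eqP e; rewrite (prim_order_dvd zP) e.
apply: (mulfI h1); rewrite mulr0.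
under eq_bigr do rewrite mulrC -exprz_exp -exprnP.
by rewrite big_mkord -subrX1 h subrr.
Qed.

(** * Fourier-Dedekind sums of subfamilies *)

Section FourierDedekind.

Variables (I : finType) (a : I -> nat) (F : numFieldType) (z : nat -> F).
Hypothesis a_gt0 : forall i, (0 < a i)%N.
Hypothesis a_coprime : forall i j, i != j -> coprime (a i) (a j).
Hypothesis z_prim : forall b, (0 < b)%N -> b.-primitive_root (z b).

Definition fd_sum (A : {set I}) (n : int) : F :=
  \sum_(m in A) (a m)%:R^-1 * \sum_(1 <= j < a m)
     z (a m) ^ (j%:Z * n) / \prod_(i in A :\ m) (1 - z (a m) ^+ (j * a i)).

Lemma root_neq0 b : (0 < b)%N -> z b != 0.
Proof.
by move=> b0; rewrite (prim_root_eq0 (z_prim b0)) -lt0n.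
Qed.

(** The term [m = i] is unchanged because [z (a i) ^+ a i = 1]; in the others the factor
    [1 - z (a m) ^+ (j * a i)], nonzero by coprimality, cancels. *)
Lemma fd_sum_shift (A : {set I}) i n : i \in A ->
  fd_sum A n - fd_sum A (n + (a i)%:Z) = fd_sum (A :\ i) n.
Proof.
move=> iA; rewrite /fd_sum -sumrB (bigD1 i) //=.
rewrite -mulrBr -sumrB [X in _ * X]big_nat big1 => [|j _].
  rewrite mulr0 add0r; apply: eq_big => [m|m /andP[mA mi]].
    by rewrite in_setD1 andbC.
  rewrite -mulrBr -sumrB; congr (_ * _).
  apply: eq_big_nat => j hj.
  have iAm : i \in A :\ m by rewrite in_setD1 eq_sym mi.
  rewrite (big_setD1 i iAm) /=.
  have -> : (A :\ m) :\ i = (A :\ i) :\ m.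
    by apply/setP => x; rewrite !in_setD1 andbCA.
  set P := \prod_(_ in _) _.
  have w1 : 1 - z (a m) ^+ (j * a i) != 0.
    rewrite subr_eq0 eq_sym -(prim_order_dvd (z_prim (a_gt0 m))).
    rewrite Gauss_dvdl ?a_coprime //; apply/negP => /dvdn_leq; lia.
  rewrite mulrDr expfzDr ?root_neq0 // invfM -PoszM -exprnP.
  move: (z (a m) ^+ _) w1 => w w1; move: P^-1 => Q; move: (_ ^ _) => x.
  by field.
rewrite mulrDr expfzDr ?root_neq0 // -PoszM -exprnP mulnC exprM.
by rewrite (prim_expr_order (z_prim (a_gt0 i))) expr1n mulr1 subrr.
Qed.

(** The sum completed by its term at [j = 0], which is 1, vanishes. *)
Lemma fd_sum_set1 i (n : nat) : (0 < n < a i)%N ->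
  fd_sum [set i] n = - (a i)%:R^-1.
Proof.
move=> hn; rewrite /fd_sum big_set1 -[RHS]mulrN1; congr (_ * _).
under eq_bigr do rewrite setDv big_set0 divr1.
have nb : ~~ (a i %| `|n%:Z|)%N by apply/negP => /dvdn_leq /=; lia.
have := sum_prim_root_exprz (z_prim (a_gt0 i)) nb.
rewrite (big_ltn (a_gt0 i)) (mul0r n%:Z) expr0z addrC => /eqP.
by rewrite addr_eq0 => /eqP.
Qed.

(** In the term of [m], the side of length [a m] contributes a full geometric sum of a nontrivial
    [a m]-th root of unity. *)
Lemma fd_sum_box (A : {set I}) :
  \sum_(k <- box_sums [seq a i | i <- enum A]) fd_sum A k.+1 = 0.
Proof.
rewrite /fd_sum exchange_big big1 // => m mA.
rewrite -mulr_sumr exchange_big big_nat big1 ?mulr0 // => j hj.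
rewrite -mulr_suml.
under [X in X / _]eq_bigr do rewrite -PoszM -exprnP mulnS exprD exprM.
rewrite -mulr_sumr sum_expr_box_sums big_map big_enum_cond (bigD1 m) ?mA //=.
have -> : \sum_(0 <= l < a m) (z (a m) ^+ j) ^+ l = 0.
  have nb : ~~ (a m %| `|j%:Z|)%N by apply/negP => /dvdn_leq /=; lia.
  rewrite -[RHS](sum_prim_root_exprz (z_prim (a_gt0 m)) nb).
  by apply: eq_bigr => l _; rewrite -exprM mulnC -PoszM exprnP.
by rewrite mul0r mulr0 mul0r.
Qed.

End FourierDedekind.

(** * Truncated exponential and Bernoulli series *)

Lemma natr_fact_neq0 k : (k`!%:R : rat) != 0.
Proof. by rewrite pnatr_eq0 -lt0n fact_gt0. Qed.

(** Power series identities up to order [d] thus become identities in a commutative ring. *)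
Lemma truncation (d : nat) :
  {S : comNzRingType & {tr : {rmorphism {poly rat} -> S} |
     forall p q, tr p = tr q <-> (forall k, (k <= d)%N -> p`_k = q`_k)}}.
Proof.
exists {poly %/ ('X^(d.+1) : {poly rat})}; exists (in_qpoly 'X^(d.+1)) => p q.
have E r : val (in_qpoly 'X^(d.+1) r) = take_poly d.+1 r.
  by rewrite /= mk_monic_Xn -Pdiv.RingMonic.take_poly_rmodp.
split=> [/(congr1 val) | h].
  rewrite !E => /polyP h k lekd.
  by have := h k; rewrite !coef_take_poly ltnS lekd.
apply/val_inj; rewrite !E; apply/polyP => k; rewrite !coef_take_poly ltnS.
by case: ifP => // /h.
Qed.

Section TruncatedSeries.

Variable d : nat.

(* Q[X] / X^(d+1), kept opaque so that its carrier does not unfold. *)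
Definition trunc_ring : comNzRingType := tag (truncation d).

Definition trunc : {rmorphism {poly rat} -> trunc_ring} :=
  sval (tagged (truncation d)).

Lemma truncP (p q : {poly rat}) :
  trunc p = trunc q <-> (forall k, (k <= d)%N -> p`_k = q`_k).
Proof. exact: (svalP (tagged (truncation d))). Qed.

(* Truncations of e^(xt), (e^(xt) - 1)/t, xt/(e^(xt) - 1) and, below,
   pole_poly, t/(1 - e^(xt)). *)
Definition exp_poly (x : rat) : {poly rat} :=
  \poly_(k < d.+1) (x ^+ k / k`!%:R).
Definition expB1_poly (x : rat) : {poly rat} :=
  \poly_(k < d.+1) (x ^+ k.+1 / k.+1`!%:R).
Definition bern_poly (x : rat) : {poly rat} :=
  \poly_(k < d.+1) (x ^+ k * (bernoulli k / k`!%:R)).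

Lemma coef_exp x k : (k <= d)%N -> (exp_poly x)`_k = x ^+ k / k`!%:R.
Proof. by move=> h; rewrite coef_poly ltnS h. Qed.
Lemma coef_expB1 x k : (k <= d)%N -> (expB1_poly x)`_k = x ^+ k.+1 / k.+1`!%:R.
Proof. by move=> h; rewrite coef_poly ltnS h. Qed.
Lemma coef_bern x k : (k <= d)%N ->
  (bern_poly x)`_k = x ^+ k * (bernoulli k / k`!%:R).
Proof. by move=> h; rewrite coef_poly ltnS h. Qed.

Lemma bin_fact_inv k j : (j <= k)%N ->
  (j`!%:R)^-1 * ((k - j)`!%:R)^-1 = 'C(k, j)%:R / k`!%:R :> rat.
Proof.
move=> jk; apply/eqP; rewrite -invfM -[X in X == _]mul1r.
rewrite eqr_div ?mulf_neq0 ?natr_fact_neq0 //.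
by rewrite mul1r -!natrM bin_fact.
Qed.

Lemma trunc_expD x y :
  trunc (exp_poly (x + y)) = trunc (exp_poly x) * trunc (exp_poly y).
Proof.
rewrite -rmorphM; apply/truncP => k kd.
rewrite coef_exp // coefM addrC exprDn mulr_suml.
apply: eq_bigr => -[j /= jk] _.
rewrite !coef_exp; try lia.
by rewrite -mulr_natl mulrACA bin_fact_inv //; ring.
Qed.

Lemma trunc_exp0 : trunc (exp_poly 0) = 1.
Proof.
rewrite -(rmorph1 trunc); apply/truncP => k kd.
rewrite coef_exp // coef1; case: k {kd} => [|k]; last by rewrite expr0n mul0r.
by rewrite fact0 divr1.
Qed.

Lemma trunc_expMn (n : nat) : trunc (exp_poly n%:R) = trunc (exp_poly 1) ^+ n.
Proof.
elim: n => [|n IHn]; first by rewrite trunc_exp0 expr0.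
by rewrite mulrSr trunc_expD IHn [RHS]exprSr.
Qed.

Lemma trunc_expB1 x : trunc 'X * trunc (expB1_poly x) = trunc (exp_poly x) - 1.
Proof.
rewrite -(rmorph1 trunc) -rmorphB -rmorphM; apply/truncP => k kd.
rewrite coefXM coefB coef1 coef_exp //; case: k kd => [|k] kd.
  by rewrite expr0 fact0 invr1 mul1r subrr.
by rewrite /= coef_expB1 ?subr0 // ltnW.
Qed.

(** Coefficientwise this is the recurrence [bernoulli_sum]. *)
Lemma trunc_bern x : trunc (bern_poly x) * trunc (expB1_poly x) = trunc x%:P.
Proof.
rewrite -rmorphM; apply/truncP => k kd; rewrite coefM coefC.
transitivity
  (x ^+ k.+1 / k.+1`!%:R * \sum_(j < k.+1) 'C(k.+1, j)%:R * bernoulli j).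
  rewrite mulr_sumr; apply: eq_bigr => -[j /= jk] _.
  rewrite coef_bern ?coef_expB1; try lia.
  rewrite -subSn //.
  transitivity (x ^+ j * x ^+ (k.+1 - j) * bernoulli j *
                (j`!%:R^-1 * (k.+1 - j)`!%:R^-1)).
    by ring.
  by rewrite bin_fact_inv -?exprD ?subnKC 1?ltnW //; ring.
rewrite bernoulli_sum; case: k kd => [|k] kd; last by rewrite mulr0.
by rewrite factS fact0 divr1 mulr1.
Qed.

End TruncatedSeries.

(** * Residues at t = 0 *)

Section ResidueOfPole.
Variable d : nat.
Local Notation B := (bern_poly d 1).
Local Notation U := (expB1_poly d 1).
Local Notation E := (exp_poly d 1).
Local Notation tr := (trunc d).

(* With b = t/(e^t - 1) and u = (e^t - 1)/t: differentiate b u = 1 and use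
   t u' = e^t - u. *)
Lemma trunc_XderivB : tr ('X * B^`()) = tr B - tr E * tr B ^+ 2.
Proof.
have BU : tr (B * U) = 1.
  by rewrite rmorphM trunc_bern polyC1 rmorph1.
(* The factor ['X] makes up for the degree lost in differentiation. *)
have XD p q : tr p = tr q -> tr ('X * p^`()) = tr ('X * q^`()).
  move=> /truncP h; apply/truncP => -[|k] kd; rewrite !coefXM //= !coef_deriv.
  by rewrite h.
have := XD _ 1; rewrite rmorph1 => /(_ _ BU).
rewrite derivM (_ : 1^`() = 0) ?mulr0 ?rmorph0; last by rewrite -polyC1 derivC.
have EU : tr ('X * U^`()) = tr E - tr U.
  rewrite -rmorphB; apply/truncP => -[|k] kd; rewrite coefXM coefB.
    by rewrite coef_exp // coef_expB1 // !expr1n !divr1 subrr.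
  rewrite /= coef_deriv coef_exp // coef_expB1 // !expr1n !mul1r.
  rewrite -[LHS]mulr_natl (factS k.+1) natrM.
  have -> : k.+2%:R = 1 + k.+1%:R :> rat by rewrite mulrS.
  have y0 : 1 + k.+1%:R != 0 :> rat by rewrite nat1r pnatr_eq0.
  have := natr_fact_neq0 k.+1; move: (_`!%:R) (k.+1%:R) y0 => x y y0 x0.
  by field; rewrite x0.
have -> : 'X * (B^`() * U + B * U^`()) = 'X * B^`() * U + B * ('X * U^`()).
  by ring.
rewrite rmorphD (rmorphM _ _ U) (rmorphM _ B) EU.
move: BU; rewrite (rmorphM _ B).
move: (tr ('X * _)) (tr B) (tr U) (tr E) => x b u e bu xe.
(* As [b] inverts [u], the differentiated equation [xe] can be solved for [x]. *)
transitivity (x * (b * u)); first by rewrite bu mulr1.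
transitivity (b * (x * u + b * (e - u)) + b * (b * u) - e * b ^+ 2).
  by ring.
by rewrite xe bu mulr0 add0r mulr1.
Qed.

(* That is, e^t / (e^t - 1)^m is the derivative of a Laurent series and so has
   no residue: e^t b^m = b^(m-1) - t (b^(m-1))' / (m-1). *)
Lemma coef_exp_bernX m : (1 < m <= d.+1)%N -> (E * B ^+ m)`_m.-1 = 0.
Proof.
case: m => // -[|m] //= md.
have : tr (E * B ^+ m.+2) =
       tr (B ^+ m.+1 - m.+1%:R^-1 *: ('X * (B ^+ m.+1)^`())).
  rewrite deriv_exp /=.
  have -> : m.+1%:R^-1 *: ('X * (B^`() * B ^+ m *+ m.+1)) = 'X * B^`() * B ^+ m.
    by rewrite mulrnAr -scaler_nat scalerA mulVf ?scale1r ?mulrA // pnatr_eq0.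
  rewrite rmorphB (rmorphM _ _ (B ^+ m)) /= trunc_XderivB !(rmorphM, rmorphXn).
  by rewrite /= !exprS; ring.
move/truncP => -> //.
rewrite coefB coefZ coefXM /= coef_deriv -[X in _ * X]mulr_natl.
by rewrite mulrA mulVf ?pnatr_eq0 // mul1r subrr.
Qed.

Definition pole_poly (x : rat) : {poly rat} := - x^-1 *: bern_poly d x.

Lemma trunc_pole x : x != 0 -> tr (pole_poly x) * tr (expB1_poly d x) = -1.
Proof.
move=> x0; rewrite -rmorphM -scalerAl -mul_polyC rmorphM /= rmorphM trunc_bern.
by rewrite -rmorphM -polyCM mulNr mulVf // polyCN polyC1 rmorphN1.
Qed.

End ResidueOfPole.

(** Multiplied by t, this is the geometric sum for e^(nt) - 1. Cancelling t costs one order, so that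
    identity is taken at order [d.+1]. *)
Lemma trunc_expB1_geom d (n : nat) :
  trunc d (expB1_poly d n%:R) =
  trunc d (expB1_poly d 1) * \sum_(0 <= j < n) trunc d (exp_poly d 1) ^+ j.
Proof.
have lowerX p q : trunc d.+1 ('X * p) = trunc d.+1 ('X * q) ->
    trunc d p = trunc d q.
  by move=> /truncP h; apply/truncP => k kd; have := h k.+1 kd; rewrite !coefXM.
have exp_lower x : trunc d (exp_poly d x) = trunc d (exp_poly d.+1 x).
  by apply/truncP => k kd; rewrite !coef_exp // leqW.
have expB1_lower x : trunc d (expB1_poly d x) = trunc d (expB1_poly d.+1 x).
  by apply/truncP => k kd; rewrite !coef_expB1 // leqW.
rewrite exp_lower !expB1_lower.
under eq_bigr do rewrite -rmorphXn.
rewrite -rmorph_sum -rmorphM; apply: lowerX.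
rewrite !rmorphM trunc_expB1 mulrA trunc_expB1 trunc_expMn subrX1 rmorph_sum.
by rewrite big_mkord; congr (_ * _); apply: eq_bigr => j _; rewrite rmorphXn.
Qed.

(** The geometric sum is (1 - e^(nt)) / (1 - e^t). *)
Lemma trunc_pole_geom d (n : nat) : (0 < n)%N ->
  trunc d (pole_poly d n%:R) * \sum_(0 <= j < n) trunc d (exp_poly d 1) ^+ j =
  trunc d (pole_poly d 1).
Proof.
move=> n0; have := @trunc_pole d n%:R; rewrite pnatr_eq0 -lt0n => /(_ n0).
have := @trunc_pole d 1 (oner_neq0 _).
rewrite (trunc_expB1_geom d n).
move: (trunc d (pole_poly d 1)) (trunc d (pole_poly d n%:R)).
move: (trunc d (expB1_poly d 1)) (\sum_(_ <= _ < _) _).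
move=> u w g h gu huw.
transitivity (- (h * w * (g * u))); first by rewrite gu mulrN1 opprK.
have -> : h * w * (g * u) = g * (h * (u * w)) by ring.
by rewrite huw mulrN1 opprK.
Qed.

(** * Residues of subfamilies and the polynomial part *)

Section PolynomialPart.

Variables (d : nat) (I : finType) (a : I -> nat).
Hypothesis a_gt0 : forall i, (0 < a i)%N.

(* Res_(t=0) e^(nt) / prod_(i in A) (1 - e^(a_i t)): the factor 'X shifts the
   coefficient so that the empty family gets residue 0. *)
Definition residue1 (A : {set I}) (n : int) : rat :=
  ('X * (exp_poly d n%:~R * \prod_(i in A) pole_poly d (a i)%:R))`_#|A|.

Lemma residue1_set0 n : residue1 set0 n = 0.
Proof. by rewrite /residue1 cards0 coefXM. Qed.

Lemma residue1_set1 i n : residue1 [set i] n = - (a i)%:R^-1.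
Proof.
rewrite /residue1 cards1 coefXM big_set1 coef0M coef_exp // coefZ coef_bern //.
have -> : bernoulli 0 = 1 by rewrite /bernoulli /= big_ord0 subr0 divr1.
by rewrite !expr0 fact0 divr1; ring.
Qed.

(** The factor 1 - e^(a_i t) turns the pole factor of [i] into t, and this t accounts for [#|A|]
    dropping by one. *)
Lemma residue1_shift (A : {set I}) i n : (#|A| <= d)%N -> i \in A ->
  residue1 A n - residue1 A (n + (a i)%:Z) = residue1 (A :\ i) n.
Proof.
move=> Ad iA; rewrite /residue1.
set p := \prod_(j in A :\ i) pole_poly d (a j)%:R.
have -> : \prod_(j in A) pole_poly d (a j)%:R = pole_poly d (a i)%:R * p.
  by rewrite (big_setD1 i iA).
have cA : #|A| = #|A :\ i|.+1 by rewrite (cardsD1 i) iA.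
have -> : ('X * (exp_poly d n%:~R * p))`_#|A :\ i| =
          ('X * ('X * (exp_poly d n%:~R * p)))`_#|A|.
  by rewrite cA [RHS]coefXM.
rewrite -coefB; move: Ad; move: #|A|; apply/truncP.
have ai : (a i)%:R != 0 :> rat by rewrite pnatr_eq0 -lt0n.
rewrite intrD -pmulrn.
have := trunc_pole d ai; have := trunc_expB1 d (a i)%:R.
rewrite rmorphB !rmorphM trunc_expD.
move: (trunc d 'X) (trunc d (expB1_poly _ _)) (trunc d (exp_poly d (a i)%:R)).
move: (trunc d (pole_poly d (a i)%:R)) (trunc d p) (trunc d (exp_poly d n%:~R)).
move=> g q e x u f xu gu.
transitivity (- (g * u) * x * (x * (e * q))); last by rewrite gu opprK mul1r.
have -> : f = x * u + 1 by rewrite xu subrK.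
by ring.
Qed.

(** Geometric sums turn every pole factor into [pole_poly d 1]; then [coef_exp_bernX] applies with
    [m = #|A|]. *)
Lemma residue1_box (A : {set I}) : (1 < #|A| <= d)%N ->
  \sum_(k <- box_sums [seq a i | i <- enum A]) residue1 A k.+1 = 0.
Proof.
case/andP=> A1 Ad; rewrite /residue1 -coef_sum.
have : trunc d (\sum_(k <- box_sums [seq a i | i <- enum A])
           'X * (exp_poly d k.+1%:~R * \prod_(i in A) pole_poly d (a i)%:R)) =
       trunc d ('X * (exp_poly d 1 * pole_poly d 1 ^+ #|A|)).
  rewrite rmorph_sum.
  under [LHS]eq_bigr do rewrite !rmorphM /= -pmulrn trunc_expMn exprS -mulrA.
  rewrite -!mulr_sumr -mulr_suml sum_expr_box_sums big_map big_enum.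
  rewrite !rmorphM rmorphXn -prodr_const rmorph_prod; congr (_ * (_ * _)).
  rewrite -big_split /=.
  by apply: eq_bigr => i _; rewrite mulrC trunc_pole_geom.
move/truncP => -> //; rewrite coefXM exprZn -scalerAr coefZ coef_exp_bernX.
  by rewrite mulr0 if_same.
by rewrite A1 (leq_trans Ad).
Qed.

End PolynomialPart.

(** Truncating each factor at degree [m] keeps this coefficient and makes the expansion run over
    finite functions, as in [poly_part]. *)
Lemma coef_prod (I : finType) (p : I -> {poly rat}) (m : nat) :
  (\prod_i p i)`_m =
  \sum_(k : {ffun I -> 'I_m.+1} | (\sum_i k i)%N == m) \prod_i (p i)`_(k i).
Proof.
have h : trunc m (\prod_i p i) =
         trunc m (\prod_i \sum_(k < m.+1) (p i)`_k *: 'X^k).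
  rewrite !rmorph_prod; apply: eq_bigr => i _; apply/truncP => k km.
  by rewrite -poly_def coef_poly ltnS km.
have /truncP -> // := h.
rewrite bigA_distr_bigA coef_sum [RHS]big_mkcond; apply: eq_bigr => k _ /=.
rewrite scaler_prod -expr_sum coefZ coefXn eq_sym.
by case: eqP => _; rewrite ?mulr1 ?mulr0.
Qed.

Lemma residue1_poly_part (d : nat) (a : 'I_d -> nat) (n : int) :
  (0 < d)%N -> residue1 d a setT n = - (poly_part a).[- n%:~R].
Proof.
move=> d0; rewrite /residue1 cardsT card_ord coefXM eqn0Ngt d0 /=.
have -> : \prod_(i in setT) pole_poly d (a i)%:R =
    ((-1) ^+ d * (\prod_i (a i)%:R)^-1) *: \prod_i bern_poly d (a i)%:R.
  rewrite (eq_bigl xpredT) => [|i]; last by rewrite inE.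
  rewrite scaler_prod; congr (_ *: _).
  rewrite -prodfV -[in (-1) ^+ _](card_ord d) -prodr_const -big_split /=.
  by apply: eq_bigr => i _; rewrite mulN1r.
rewrite -scalerAr coefZ coefMr /poly_part hornerZ.
rewrite [_ * (\prod__ _)^-1]mulrC -!mulrA -mulrN; congr (_ * _).
rewrite horner_sum mulr_sumr -sumrN (prednK d0).
apply: eq_bigr => -[m /= md] _.
rewrite hornerZ hornerXn coef_exp; last by lia.
rewrite coef_prod -subn1 (exprNn n%:~R).
rewrite (eq_bigr (fun k : {ffun 'I_d -> 'I_m.+1} => \prod_(i < d)
   ((a i)%:R ^+ k i * (bernoulli (k i) / (k i)`!%:R)))) => [|k _]; last first.
  apply: eq_bigr => i _; rewrite coef_bern //.
  by have := ltn_ord (k i); rewrite ltnS => /leq_trans; apply; apply: ltnW.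
move: (\sum_(k : {ffun _} | _) _) => S.
(* The sign on the left comes from the pole factors; on the right, one comes from [poly_part] and
   one from the power of [- n]. *)
have -> : (-1) ^+ d = - ((-1) ^+ m * (-1) ^+ (d - 1 - m)) :> rat.
  by rewrite -exprD -[RHS]mulN1r -exprS; congr (_ ^+ _); lia.
by ring.
Qed.

(** * The full family and the three ranges of n *)

Lemma min_fam_le (d : nat) (hd : (0 < d)%N) (a : 'I_d -> nat) (i : 'I_d) :
  (min_fam hd a <= a i)%N.
Proof.
rewrite /min_fam; elim: (index_enum _) (mem_index_enum i) => // j s IHs.
rewrite big_cons inE geq_min => /orP[/eqP <-|/IHs ->]; first by rewrite leqnn.
by rewrite orbT.
Qed.

Lemma fourier_dedekind_fd_sum (R : realType) (d : nat) (a : 'I_d -> nat) n :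
  \sum_(m < d) fourier_dedekind R [seq a i | i <- enum 'I_d & i != m] (a m) n
  = fd_sum a (xi R) setT n.
Proof.
rewrite /fd_sum; apply: eq_big => [m|m _]; first by rewrite inE.
rewrite /fourier_dedekind; congr (_ * _); apply: eq_bigr => j _; congr (_ / _).
rewrite big_map big_filter big_enum_cond.
by apply: eq_bigl => i; rewrite !inE andbT.
Qed.

Theorem theorem26 (R : realType) (d : nat) (hd : (0 < d)%N) (a : 'I_d -> nat)
    (a_gt0 : forall i, (0 < a i)%N)
    (a_coprime : forall i j, i != j -> coprime (a i) (a j))
    (n : int)
    (hn : [\/ 1 - (min_fam hd a)%:Z <= n <= -1,
              1 <= n <= (\sum_(i < d) a i)%N%:Z - 1
            | (\sum_(i < d) a i)%N%:Z + 1 <= n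
                <= (\sum_(i < d) a i)%N%:Z + (min_fam hd a)%:Z - 1]) :
  \sum_(m < d) fourier_dedekind R [seq a i | i <- enum 'I_d & i != m] (a m) n
  = - ratr (poly_part a).[- n%:~R].

Proof.
pose g (A : {set 'I_d}) (k : int) : R[i] :=
  fd_sum a (xi R) A k - ratr (residue1 d a A k).
have xiP b : (0 < b)%N -> b.-primitive_root (xi R b) by exact: xi_prim.
have cardA (A : {set 'I_d}) : (#|A| <= d)%N.
  by rewrite -[d in X in (_ <= X)%N]card_ord max_card.
have g_set0 k : g set0 k = 0.
  by rewrite /g /fd_sum big_set0 residue1_set0 rmorph0 subrr.
have g_shift (A : {set 'I_d}) i k : i \in A ->
    g A k - g A (k + (a i)%:Z) = g (A :\ i) k.
  move=> iA; rewrite /g -(fd_sum_shift a_gt0 a_coprime xiP) //.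
  by rewrite -(residue1_shift a_gt0) // rmorphB; ring.
(* Both parts equal -1/a_i. *)
have g_set1 i (k : nat) : (0 < k < a i)%N -> g [set i] k = 0.
  move=> hk; rewrite /g (fd_sum_set1 a_gt0 xiP) // residue1_set1.
  by rewrite rmorphN fmorphV /= ratr_nat subrr.
have g_sum (A : {set 'I_d}) : (1 < #|A|)%N -> exists s : seq nat,
    [/\ (0 < size s)%N, all (fun k => 0 < k < \sum_(i in A) a i)%N s
      & \sum_(k <- s) g A k = 0].
  move=> A1; exists [seq k.+1 | k <- box_sums [seq a i | i <- enum A]]; split.
  - rewrite size_map size_box_sums_gt0 //; apply/allP => _ /mapP[i _ ->].
    exact: a_gt0.
  (* Box entries satisfy k + |A| <= sum of the a_i, so k + 1 is below the sum as |A| >= 2. *)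
  - apply/allP => _ /mapP[k /box_sums_bound + ->].
    rewrite size_map -cardE sumnE big_map big_enum /=.
    by apply: leq_trans; rewrite -addn2 leq_add2l.
  - rewrite big_map sumrB (fd_sum_box a_gt0 xiP) -rmorph_sum residue1_box //.
      by rewrite rmorph0 subrr.
    by rewrite A1 cardA.
suff : g setT n = 0.
  move/eqP; rewrite subr_eq0 residue1_poly_part // rmorphN => /eqP <-.
  exact: fourier_dedekind_fd_sum.
have sumT : (\sum_(i in [set: 'I_d]) a i = \sum_(i < d) a i)%N.
  by apply: eq_bigl => i; rewrite inE.
case: hn => /andP[h1 h2].
- have -> : n = - `|n|%:Z by lia.
  apply: (vanishing_negative a_gt0 a_coprime g_set0 g_shift g_set1 g_sum).
    by lia.
  by move=> i _; have := min_fam_le hd a i; lia.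
- have -> : n = `|n|%:Z by lia.
  apply: (vanishing_middle a_gt0 a_coprime g_set0 g_shift g_set1 g_sum).
  by rewrite sumT; lia.
- have -> : n = (\sum_(i in [set: 'I_d]) a i + (`|n| - \sum_(i < d) a i))%N.
    by rewrite sumT; lia.
  apply: (vanishing_top a_gt0 a_coprime g_set0 g_shift g_set1 g_sum).
    by lia.
  by move=> i _; have := min_fam_le hd a i; lia.
Qed.
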